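(* Let $\mathsf{D}(n)$ denote, for $n \in \mathbb{N}^+$, the minimum size of a set $A \subseteq \mathbb{Z}$ with $A - A \supseteq \{1, \ldots, n\}$, and let $\mathsf{d}^\ast = \lim_{n \to \infty} \mathsf{D}(n)^2/n$. There exists $\epsilon > 0$ such that \[ \mathsf{d}^\ast \,\geq\, \epsilon + 2 - 2\inf_{\theta \neq 0} \frac{\sin(\theta)}{\theta}. \]
   Context: For $A \subseteq \mathbb{Z}$, $A - A \coloneqq \{a - b : a, b \in A\}$. A set $A \subseteq \mathbb{Z}$ is a difference basis with respect to $n$ if $A - A \supseteq \{1,\ldots,n\}$; $\mathsf{D}(n)$ is the smallest size of such a set. It is a known result (Rédei–Rényi) that the limit $\lim_{n\to\infty} \mathsf{D}(n)^2/n$ exists; $\mathsf{d}^\ast$ denotes this limit. Here $\inf_{\theta\neq 0} \sin(\theta)/\theta = -0.2172\ldots$, so $2 - 2\inf_{\theta\neq0}\sin(\theta)/\theta = 2.4344\ldots$. *)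

(* Defs.v *)
From HB Require Import structures.
From mathcomp Require Import all_boot all_order all_algebra finmap.
From mathcomp Require Import all_classical all_reals all_analysis.

Set Implicit Arguments.
Unset Strict Implicit.
Unset Printing Implicit Defensive.

Import Order.TTheory GRing.Theory Num.Theory.
Import numFieldNormedType.Exports.

Local Open Scope classical_set_scope.
Local Open Scope ring_scope.

Definition diffset (A : set int) : set int :=
  [set x | exists2 a, A a & exists2 b, A b & x = a - b].

Definition difference_basis (n : nat) (A : set int) : Prop :=
  [set m : int | 1 <= m <= n%:Z] `<=` diffset A.

(* Restricting to finite sets loses nothing: a finite basis always exists, so
   infinite ones never attain the minimum size. *)
Definition has_basis_of_size (n k : nat) : Prop :=
  exists2 A : {fset int}, difference_basis n [set` A] & #|` A|%fset = k.

Lemma ex_basis_size (n : nat) : exists k, `[< has_basis_of_size n k >].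
Proof.
pose A : {fset int} := [fset x in [seq i%:Z | i <- iota 0 n.+1]]%fset.
have inA i : (i <= n)%N -> i%:Z \in A.
  by move=> le_in; rewrite in_fset; apply/mapP; exists i; rewrite // mem_iota.
exists #|` A|%fset; apply/asboolP; exists A => //.
move=> [m|m] /= => [|//] /andP[m1 mn].
exists m%:Z; first exact: inA.
by exists 0; [exact: (inA 0%N) | rewrite subr0].
Qed.

Definition Dmin (n : nat) : nat := ex_minn (ex_basis_size n).

Definition sinc_inf (R : realType) : R :=
  inf [set sin t / t | t in [set t : R | t != 0]].

(* Main.v *)
Require Import Defs.
From HB Require Import structures.
From mathcomp Require Import all_boot all_order all_algebra finmap.
From mathcomp Require Import all_classical all_reals all_analysis.
From mathcomp Require Import ring lra zify.

Set Implicit Arguments.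
Unset Strict Implicit.
Unset Printing Implicit Defensive.

Import Order.TTheory GRing.Theory Num.Theory.
Import numFieldNormedType.Exports.

Local Open Scope classical_set_scope.
Local Open Scope ring_scope.

(* Let - s = sin t / t = cos t be the minimum of the cardinal sine and let A be a basis for n
   with k elements. Put z_a = exp (i t a / n). Expanding |sum_a z_a|^2 >= 0 over differences
   gives k^2 >= (2 + 2s) n - O(1). Suppose k^2 is at most (2 + 2s + xi) n. Then sum_a z_a is
   o(k), and the 2sn + o(n) pairs left over after each difference d with 0 < |d| <= n has been
   represented once satisfy z_a = z_b up to o(1), for most of them. Representing each
   difference once contributes only a bounded density on the circle, so these close pairs must
   come from a single cluster C, with |C|^2 = 2sn + o(n). The pairs between C and its
   complement B have z_c / z_b with average real part about - |C| / |B|; but apart from pairs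
   where it is close to 1 they use each difference at most once, so the sum over them of
   Re (z_c / z_b) + s is at least the sum of the negative parts of cos (t d / n) + s over
   0 < |d| <= n. In the limit this reads sqrt (s (1 + s)) - s >= 1 - pi / t, which is false. *)

(** * Mean value bounds for sine and cosine *)

Lemma sin_sub_mvt (R : realType) (x y : R) : x <= y ->
  exists2 z, x <= z <= y & sin y - sin x = cos z * (y - x).
Proof.
move=> xy; have [|z zxy ->] := @MVT_segment R sin cos x y xy (fun z _ => is_derive_sin z).
  by apply: continuous_subspaceT; exact: continuous_sin.
by exists z => //; rewrite in_itv in zxy.
Qed.

Lemma cos_sub_mvt (R : realType) (x y : R) : x <= y ->
  exists2 z, x <= z <= y & cos y - cos x = - sin z * (y - x).
Proof.
move=> xy.
have [|z zxy ->] :=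
  @MVT_segment R cos (fun z => - sin z) x y xy (fun z _ => is_derive_cos z).
  by apply: continuous_subspaceT; exact: continuous_cos.
by exists z => //; rewrite in_itv in zxy.
Qed.

Lemma sin_le_id (R : realType) (x : R) : 0 <= x -> sin x <= x.
Proof.
move=> x0; have [z _] := sin_sub_mvt x0; rewrite sin0 !subr0 => ->.
by rewrite ler_piMl // cos_le1.
Qed.

Lemma cos_half_angle (R : realType) (x : R) : cos x = 1 - 2 * sin (x / 2) ^+ 2.
Proof.
have {1}-> : x = (x / 2) *+ 2 by rewrite -mulr_natr mulfVK.
by rewrite cos_mulr2n cos2sin2; ring.
Qed.

Lemma cos_ge_quadratic (R : realType) (x : R) : 0 <= x <= 2 -> 1 - x ^+ 2 / 2 <= cos x.
Proof.
move=> /andP[x0 x2]; rewrite cos_half_angle.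
have h0 : 0 <= x / 2 by lra.
have s0 : 0 <= sin (x / 2).
  by apply: sin_ge0_pi; have := @pi_ge2 R; lra.
have := sin_le_id h0; nra.
Qed.

Lemma sin_ge_cubic (R : realType) (x : R) : 0 <= x <= 2 -> x * (1 - x ^+ 2 / 2) <= sin x.
Proof.
move=> /andP[x0 x2]; have [z /andP[z0 zx]] := sin_sub_mvt x0.
rewrite sin0 !subr0 => ->; rewrite mulrC ler_wpM2r //.
have /cos_ge_quadratic : 0 <= z <= 2 by lra.
by apply: le_trans; nra.
Qed.

(** * The minimum of the cardinal sine *)

(** Two angle doublings from 39/100 show that the cosine is still positive at 39/25. *)
Lemma pihalf_ge156 (R : realType) : 39 / 25 <= pi / 2 :> R.
Proof.
have c39 : 0 <= (39 / 100 : R) <= 2 by lra.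
have /cos_ge_quadratic c1 := c39.
have c2 : cos (78 / 100 : R) = cos (39 / 100) ^+ 2 *+ 2 - 1.
  by rewrite -cos_mulr2n; congr cos; lra.
have c3 : cos (39 / 25 : R) = cos (78 / 100) ^+ 2 *+ 2 - 1.
  by rewrite -cos_mulr2n; congr cos; lra.
(* Since [2 * 29 ^ 2 = 41 ^ 2 + 1], 29/41 lies just above sqrt (1/2), where the second doubling
   would give 0. *)
have c78 : 29 / 41 <= cos (78 / 100 : R) by rewrite c2; nra.
have c156 : 0 < cos (39 / 25 : R) by rewrite c3; nra.
have pi2 := @pi_ge2 R; rewrite leNgt; apply/negP => lt.
suff : cos (39 / 25 : R) < cos (pi / 2) by rewrite cos_pihalf; lra.
by rewrite ltr_cos // in_itv /=; lra.
Qed.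

(* [t] is the root of [tan t = t] in (pi, 3 pi / 2), about 4.4934, written as
   [3 pi / 2 - v] with [v] in (0, 0.222); [s] is about 0.2172. In the last clause [1 - pi / t]
   is about 0.3008, and 20/47 approximates the optimal weight [sqrt (s / (1 + s))], for which
   the left-hand side is [2 (sqrt (s (1 + s)) - s)], about 0.5940. *)
Lemma sinc_critical_point (R : realType) : exists t s : R,
  [/\ pi < t < 3 / 2 * pi, cos t = - s, sin t = - s * t,
      4 / 25 < s < 111 / 500 /\ 1 <= s * (2 * pi)
    & s * (47 / 20) + (1 + s) * (20 / 47) - 2 * s < 2 * (1 - pi / t)].
Proof.
set p : R := pi / 2; have p156 : 39 / 25 <= p := pihalf_ge156 R.
have p2 : p < 2 := pihalf_lt2 R.
have piE : pi = 2 * p :> R by rewrite /p; lra.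
(* A zero of [q] solves [tan t = t] at [t = 3 * p - v]. *)
pose a : R := 111 / 500; pose q (v : R) := (3 * p - v) * sin v - cos v.
(* Half angles sharpen the cubic bound on [sin] and yield an upper bound on [cos]. *)
have sa : 219 / 1000 <= sin a /\ cos a <= 41 / 42.
  have h : 0 <= (a / 2 : R) <= 2 by rewrite /a; lra.
  have := sin_ge_cubic h; have := cos_ge_quadratic h.
  set S := sin (a / 2); set C := cos (a / 2) => hC hS.
  have -> : sin a = 2 * C * S by rewrite [a in LHS]splitr -mulr2n sin_mulr2n -/S -/C; ring.
  rewrite (cos_half_angle a) -/S.
  have {}hC : 161 / 162 <= C by move: hC; rewrite /a; lra.
  have {}hS : 15 / 136 <= S by move: hS; rewrite /a; lra.
  by split; nra.
have [v] : exists2 v, v \in `[0, a] & q v = 0.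
  apply: IVT; first by rewrite /a; lra.
    apply: derivable_within_continuous => x _.
    apply: derivableB; last exact: derivable_cos.
    by apply: derivableM; [apply: derivableB|exact: derivable_sin].
  have q0 : q 0 < 0 by rewrite /q sin0 cos0; lra.
  have qa : 0 < q a by rewrite /q; case: sa; rewrite /a; nra.
  by rewrite ge_min le_max (ltW q0) (ltW qa) orbT.
rewrite in_itv /= => /andP[v0 va] qv.
have {}qv : cos v = (3 * p - v) * sin v by move: qv; rewrite /q; lra.
have a2 : a <= 1 by rewrite /a; lra.
have cv : 39 / 40 <= cos v.
  have h : 0 <= v <= 2 by lra.
  by have := cos_ge_quadratic h; move: va; rewrite /a; nra.
have sv : sin v <= v by exact: sin_le_id.
have va' : v < a.
  rewrite lt_neqAle va andbT; apply/eqP => vE; case: sa.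
  rewrite -vE; move: qv; rewrite vE /a; nra.
have sv1 : 13 / 80 <= sin v.
  rewrite leNgt; apply/negP => lt.
  have s0 : 0 <= sin v by apply: sin_ge0_pi; rewrite piE; lra.
  have : (3 * p - v) * sin v <= 6 * sin v by apply: ler_wpM2r; lra.
  lra.
have cosE x : cos (3 * p - x) = - sin x :> R.
  have -> : 3 * p - x = (- x + pi / 2) + pi by rewrite -/p piE; ring.
  by rewrite cosDpi cosDpihalf sinN opprK.
have sinE' x : sin (3 * p - x) = - cos x :> R.
  have -> : 3 * p - x = (- x + pi / 2) + pi by rewrite -/p piE; ring.
  by rewrite sinDpi sinDpihalf cosN.
exists (3 * p - v), (sin v); split.
- by rewrite piE; move: va; rewrite /a; lra.
- exact: cosE.
- by rewrite sinE' qv; ring.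
- rewrite piE; split; first by move: va'; rewrite /a; lra.
  by nra.
- have t0 : 0 < 3 * p - v by lra.
  have -> : 1 - pi / (3 * p - v) = (p - v) / (3 * p - v).
    by rewrite piE; field; rewrite lt0r_neq0.
  rewrite (mulrA 2) ltr_pdivlMr //.
  have va2 : v < 111 / 500 by exact: va'.
  have : sin v * (47 / 20) + (1 + sin v) * (20 / 47) - 2 * sin v <= v * (47 / 20) + (1 + v) * (20 / 47) - 2 * v by lra.
  have : v * (47 / 20) + (1 + v) * (20 / 47) - 2 * v <= 3 / 5 by lra.
  move=> h1 h2; have {h1}h2 := le_trans h2 h1.
  apply: (@le_lt_trans _ _ (3 / 5 * (3 * p - v))); last by lra.
  by rewrite ler_wpM2r // ltW.
Qed.

(** As [sin t = t * cos t], the tangent to the sine at [t] is the line through the origin of slope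
    [- s]. The sine is above it up to pi by sign, on [pi, 2 pi] by convexity, and afterwards because
    the line is at most -1. *)
Lemma sinc_inf_ge (R : realType) (t s : R) :
  pi < t < 3 / 2 * pi -> cos t = - s -> sin t = - s * t -> 1 <= s * (2 * pi) ->
  - s <= sinc_inf R.
Proof.
move=> /andP[pit t32] ct st s2pi.
have pi2 := @pi_ge2 R; have s0 : 0 < s by nra.
have pos x : 0 < x -> - s * x <= sin x.
  move=> x0; have [xpi|pix] := leP x pi.
    have : 0 <= sin x by apply: sin_ge0_pi; rewrite (ltW x0).
    nra.
  have [x2pi|] := leP (2 * pi) x.
    have := sin_geN1 x; nra.
  move=> x2pi.
  (* [cos] increases on [pi, 2 pi], so the graph of [sin] lies above its tangent line at [t] there. *)
  have cosI y z : pi <= y -> y <= z -> z <= 2 * pi -> cos y <= cos z.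
    move=> piy yz z2; have -> : cos y = - cos (y - pi) by rewrite -[X in cos X](subrK pi) cosDpi.
    have -> : cos z = - cos (z - pi) by rewrite -[X in cos X](subrK pi) cosDpi.
    rewrite lerN2; have [->//|ne] := eqVneq y z.
    by apply/ltW; rewrite ltr_cos ?in_itv /=; lra.
  have [tx|/ltW xt] := leP t x.
    have [z /andP[tz zx]] := sin_sub_mvt tx; rewrite st => e.
    have : cos t <= cos z by apply: cosI; lra.
    rewrite ct; nra.
  have [z /andP[xz zt]] := sin_sub_mvt xt; rewrite st => e.
  have : cos z <= cos t by apply: cosI; lra.
  rewrite ct; nra.
apply: lb_le_inf; first by exists (sin 1 / 1), 1 => //=; exact: oner_neq0.
move=> _ [x /= x0 <-]; have [xp|xn] := ltP 0 x.
  by rewrite ler_pdivlMr // pos.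
have {}xn : x < 0 by rewrite lt_neqAle x0.
rewrite -[x]opprK sinN invrN mulrNN ler_pdivlMr ?oppr_gt0 //.
by rewrite pos // oppr_gt0.
Qed.

(** * Riemann sums of the cosine *)

Lemma cos_lipschitz (R : realType) (x y : R) : x <= y -> `|cos y - cos x| <= y - x.
Proof.
move=> xy; have [z _ ->] := cos_sub_mvt xy.
rewrite normrM normrN (ger0_norm (_ : 0 <= y - x)) ?subr_ge0 //.
by rewrite ler_piMl ?subr_ge0 // sin_max.
Qed.

Lemma sin_lipschitz (R : realType) (x y : R) : x <= y -> `|sin y - sin x| <= y - x.
Proof.
move=> xy; have [z _ ->] := sin_sub_mvt xy.
rewrite normrM (ger0_norm (_ : 0 <= y - x)) ?subr_ge0 //.
by rewrite ler_piMl ?subr_ge0 // cos_max.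
Qed.

Lemma cos_sum_approx (R : realType) (h : R) (m n : nat) : 0 <= h -> (m <= n)%N ->
  `|h * (\sum_(m <= i < n) cos (h * i.+1%:R)) - (sin (h * n%:R) - sin (h * m%:R))|
    <= (n - m)%:R * h ^+ 2.
Proof.
move=> h0 mn; rewrite -(telescope_sumr (fun i => sin (h * i%:R))) //.
rewrite mulr_sumr -sumrB (le_trans (ler_norm_sum _ _ _)) //.
rewrite mulr_natl -sumr_const_nat; apply: ler_sum => i _.
have hi : h * i%:R <= h * i.+1%:R by rewrite ler_wpM2l // ler_nat.
have [z /andP[z1 z2] ->] := sin_sub_mvt hi.
have := cos_lipschitz z2; rewrite !ler_norml => /andP[c1 c2].
have hE : h * i.+1%:R = h * i%:R + h by rewrite -natr1; ring.
move: c1 c2 z1 z2; rewrite hE; set a := h * i%:R; set c := cos (a + h); set d := cos z.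
by move=> c1 c2 z1 z2; apply/andP; split; nra.
Qed.

(** * Chordal distance on the circle *)

(** As [1 - cos x] is half of |1 - exp (i x)|^2, this is the squared triangle inequality, with |u +
    v|^2 <= 2 |u|^2 + 2 |v|^2. *)
Lemma one_sub_cosD (R : realType) (x y : R) :
  1 - cos (x + y) <= 2 * (1 - cos x) + 2 * (1 - cos y).
Proof.
rewrite (cos_half_angle (x + y)) (cos_half_angle x) (cos_half_angle y) (mulrDl x y) sinD.
have := cos2Dsin2 (x / 2); have := cos2Dsin2 (y / 2).
set a := cos (x / 2); set b := sin (x / 2); set c := cos (y / 2); set d := sin (y / 2).
move=> cd ab.
have h : (b * c + a * d) ^+ 2 <= 2 * ((b * c) ^+ 2 + (a * d) ^+ 2).
  have := sqr_ge0 (b * c - a * d); nra.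
have b1 : (b * c) ^+ 2 <= b ^+ 2.
  rewrite exprMn ler_piMr ?sqr_ge0 //; have := sqr_ge0 d; lra.
have d1 : (a * d) ^+ 2 <= d ^+ 2.
  rewrite exprMn ler_piMl ?sqr_ge0 //; have := sqr_ge0 b; lra.
lra.
Qed.

(* Half the squared chordal distance between [exp (i h a)] and [exp (i h b)], as a
   function of [m = a - b]. *)
Definition defect (R : realType) (h : R) (m : int) : R := 1 - cos (h * m%:~R).

Lemma defect_ge0 (R : realType) (h : R) (m : int) : 0 <= defect h m.
Proof. by rewrite subr_ge0 cos_le1. Qed.

Lemma defectN (R : realType) (h : R) (m : int) : defect h (- m) = defect h m.
Proof. by rewrite /defect mulrNz mulrN cosN. Qed.

Lemma defectD (R : realType) (h : R) (m m' : int) :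
  defect h (m + m') <= 2 * defect h m + 2 * defect h m'.
Proof. by rewrite /defect intrD mulrDr one_sub_cosD. Qed.

(** * Sums over the differences of a basis *)

Lemma ler_sum_subset (R : realDomainType) (T : eqType) (s1 s2 : seq T) (G : T -> R) :
  uniq s1 -> {subset s1 <= s2} -> (forall x, 0 <= G x) ->
  \sum_(x <- s1) G x <= \sum_(x <- s2) G x.
Proof.
move=> + + G0; elim: s1 s2 => [|x s1 IH] s2 /=; first by rewrite big_nil sumr_ge0.
move=> /andP[xs1 us1] sub.
have xs2 : x \in s2 by apply: sub; rewrite mem_head.
rewrite big_cons (perm_big _ (perm_to_rem xs2)) big_cons lerD2l; apply: IH => // y ys1.
apply: rem_mem; last by apply: sub; rewrite inE ys1 orbT.
by apply: contraNneq xs1 => <-.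
Qed.

Definition sym_range (n : nat) : seq int :=
  [seq (i.+1)%:Z | i <- iota 0 n] ++ [seq - (i.+1)%:Z | i <- iota 0 n].

Lemma sym_range_uniq (n : nat) : uniq (sym_range n).
Proof.
rewrite cat_uniq !map_inj_uniq ?iota_uniq /= ?andbT; last 2 first.
- by move=> i j /oppr_inj [].
- by move=> i j [].
by apply/hasPn => _ /mapP[i _ ->]; apply/negP => /mapP[j _].
Qed.

Lemma sum_sym_range (R : zmodType) (n : nat) (G : int -> R) :
  \sum_(d <- sym_range n) G d =
  \sum_(0 <= i < n) (G (i.+1)%:Z + G (- (i.+1)%:Z)).
Proof. by rewrite big_cat !big_map /= big_split /index_iota subn0. Qed.

Lemma mem_sym_range (n : nat) (d : int) : d \in sym_range n -> - n%:Z <= d <= n%:Z.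
Proof.
by rewrite mem_cat => /orP[] /mapP[i]; rewrite mem_iota add0n => /andP[_ lt] ->; lia.
Qed.

Definition covers (n : nat) (A : seq int) : Prop :=
  forall i, (i < n)%N -> exists a b : int, [/\ a \in A, b \in A & (i.+1)%:Z = a - b].

Lemma sum_diff_ge (R : realDomainType) (n : nat) (A : seq int) (G : int -> R) :
  covers n A -> (forall d, 0 <= G d) ->
  \sum_(d <- sym_range n) G d <= \sum_(a <- A) \sum_(b <- A) G (a - b).
Proof.
move=> cov G0.
rewrite -(big_allpairs_dep (h := fun a b => a - b) (r1 := A) (r2 := fun=> A)
  (F := G)) ler_sum_subset ?sym_range_uniq // => d.
rewrite mem_cat => /orP[] /mapP[i]; rewrite mem_iota add0n => /andP[_ lt] ->.
  have [a [b [aA bA ->]]] := cov _ lt.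
  by apply/allpairsP; exists (a, b).
have [a [b [aA bA ->]]] := cov _ lt.
by apply/allpairsP; exists (b, a); rewrite opprB.
Qed.

Definition excess (R : realType) (h : R) (n : nat) (A : seq int) : R :=
  \sum_(a <- A) \sum_(b <- A) defect h (a - b) - \sum_(d <- sym_range n) defect h d.

(* The excess is the total defect of the pairs of [A] left over once each [d] with
   [0 < |d| <= n] has received one representation, so it controls every function
   dominated by the defect on those left-over pairs. *)
Lemma sum_diff_le (R : realType) (h c : R) (n : nat) (A : seq int) (G : int -> R) :
  covers n A -> (forall d, G d <= c * defect h d) ->
  \sum_(a <- A) \sum_(b <- A) G (a - b) <=
  \sum_(d <- sym_range n) G d + c * excess h n A.
Proof.
move=> cov Gle.
have Gge d : 0 <= c * defect h d - G d by rewrite subr_ge0.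
have := sum_diff_ge cov Gge; rewrite sumrB -mulr_sumr.
have -> : \sum_(a <- A) \sum_(b <- A) (c * defect h (a - b) - G (a - b)) =
    c * (\sum_(a <- A) \sum_(b <- A) defect h (a - b)) - \sum_(a <- A) \sum_(b <- A) G (a - b).
  by rewrite mulr_sumr -sumrB; apply: eq_bigr => a _; rewrite mulr_sumr -sumrB.
by rewrite /excess; lra.
Qed.

(** * Sparse arcs and clusters *)

(** Two members of the window have mutual defect below [1 - cos (t / (4 * M%:R))], while a shift by
    [j * l] with [0 < j < M] turns by an angle between [t / (4 * M%:R)] and pi. So [M] disjoint
    shifted copies fit into [-n, 2n]. *)
Lemma window_count (R : realType) (t : R) (M n : nat) (D : int) :
  0 < t <= 2 * pi -> (0 < M)%N -> (4 * M <= n)%N ->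
  M%:R * (\sum_(d <- sym_range n)
    (defect (t / n%:R) (d - D) < (1 - cos (t / (4 * M%:R))) / 4)%R%:R) <= (3 * n + 1)%:R :> R.
Proof.
move=> /andP[t0 tpi] M0 Mn.
set h := t / n%:R; set q := 1 - cos (t / (4 * M%:R)).
have n0 : (0 < n)%N by lia.
have nR0 : 0 < n%:R :> R by rewrite ltr0n.
have MR1 : 1 <= M%:R :> R by rewrite ler1n.
set W : seq int := [seq d <- sym_range n | defect h (d - D) < q / 4].
have -> : \sum_(d <- sym_range n) (defect h (d - D) < q / 4)%R%:R = (size W)%:R :> R.
  rewrite size_filter -sum1_count natr_sum [RHS]big_mkcond /=.
  by apply: eq_bigr => d _; case: ifP.
(* The translates of the window by [0, l, .., (M - 1) l] are disjoint. *)
set l := (n %/ (2 * M))%N.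
have lM : (l * (2 * M) <= n)%N by exact: leq_divM.
have ln : (n <= l * (4 * M))%N by rewrite /l; nia.
have sep j : (0 < j < M)%N -> q <= defect h (j * l)%N%:Z.
  move=> /andP[j0 jM]; rewrite /q /defect lerB // -pmulrn.
  have hjl : h * (j * l)%:R = t * ((j * l)%:R / n%:R) by rewrite /h; ring.
  have lo : t / (4 * M%:R) <= h * (j * l)%:R.
    rewrite hjl ler_pM2l // ler_pdivlMr // mulrC ler_pdivrMr; last by lra.
    by rewrite -!natrM ler_nat; nia.
  have hi : h * (j * l)%:R <= pi.
    rewrite hjl; apply: (@le_trans _ _ (t * (1 / 2))); last by lra.
    rewrite ler_pM2l // ler_pdivrMr // mulrC mul1r ler_pdivlMr //.
    by rewrite -natrM ler_nat; nia.
  have pos : 0 <= t / (4 * M%:R) by rewrite divr_ge0 //; lra.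
  have [->//|ne] := eqVneq (t / (4 * M%:R)) (h * (j * l)%:R).
  apply/ltW; rewrite ltr_cos ?in_itv /= ?lt_neqAle ?ne ?lo ?pos ?hi ?(le_trans pos lo) //.
  by rewrite (le_trans lo hi).
have close d d' : d \in W -> d' \in W -> defect h (d - d') < q.
  rewrite !mem_filter => /andP[wd _] /andP[wd' _].
  have -> : d - d' = (d - D) + - (d' - D) by ring.
  by apply: le_lt_trans (defectD _ _ _) _; rewrite defectN; lra.
have key : (M * size W <= 3 * n + 1)%N.
  have -> : (M * size W = size [seq (d + (j * l)%N%:Z)%R | d : int <- W, j : nat <- iota 0 M])%N.
    by rewrite size_allpairs size_iota mulnC.
  have -> : (3 * n + 1 = size [seq (i%:Z - n%:Z)%R | i <- iota 0 (3 * n + 1)])%N.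
    by rewrite size_map size_iota.
  apply: uniq_leq_size.
    apply: allpairs_uniq; rewrite ?iota_uniq ?filter_uniq ?sym_range_uniq //.
    move=> _ _ /allpairsP[[d j] [/= dW jM ->]] /allpairsP[[d' j'] [/= dW' jM' ->]] /= e.
    have aux (d1 d2 : int) (j1 j2 : nat) : d1 \in W -> d2 \in W -> (j2 < M)%N ->
        d1 + (j1 * l)%N%:Z = d2 + (j2 * l)%N%:Z -> (j1 < j2)%N -> False.
      move=> d1W d2W j2M e12 lt12.
      have := close _ _ d1W d2W.
      have -> : d1 - d2 = ((j2 - j1) * l)%N%:Z.
        have jl : (j1 * l <= j2 * l)%N by rewrite leq_mul2r (ltnW lt12) orbT.
        by rewrite mulnBl -subzn //; move: e12; clear; lia.
      by rewrite ltNge sep // subn_gt0 lt12 (leq_ltn_trans (leq_subr _ _) j2M).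
    move: jM jM'; rewrite !mem_iota /= add0n => jM jM'.
    have [lt|gt|eq] := ltngtP j j'; first by case: (aux d d' j j').
      by case: (aux d' d j' j).
    by move: e; rewrite eq => /addIr ->.
  move=> _ /allpairsP[[d j] [/= dW jM ->]].
  move: dW; rewrite mem_filter => /andP[_ /mem_sym_range dn].
  move: jM; rewrite mem_iota add0n => /andP[_ jM].
  have jl : (j * l <= n)%N by nia.
  apply/mapP; exists (absz (d + (j * l)%N%:Z + n%:Z)); last by lia.
  by rewrite mem_iota; lia.
by rewrite -natrM ler_nat.
Qed.

Lemma sum_const_seq (R : nzRingType) (T : Type) (A : seq T) (x : R) :
  \sum_(a <- A) x = x * (size A)%:R.
Proof. by rewrite big_const_seq count_predT iter_addr_0 mulr_natr. Qed.

(* Two separated clusters would have a product set of pairs whose differences all lie in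
   a short arc away from 1, contradicting [sparse]; hence all points with many close
   neighbours lie near [a0]. *)
Lemma cluster (R : realType) (h kap eta : R) (A : seq int) :
  0 < kap -> 0 <= eta ->
  (forall D, 10 * kap <= defect h D ->
    \sum_(a <- A) \sum_(b <- A)
      ((defect h (a - b - D) < 4 * kap) && (kap <= defect h (a - b)))%R%:R
    < eta ^+ 2 * (size A)%:R ^+ 2) ->
  exists a0, \sum_(a <- A) \sum_(b <- A) (defect h (a - b) < kap)%R%:R <=
    eta * (size A)%:R ^+ 2 + (\sum_(b <- A) (defect h (a0 - b) < 22 * kap)%R%:R) ^+ 2.
Proof.
move=> kap0 eta0 sparse; set k : R := (size A)%:R.
have k0 : 0 <= k by rewrite ler0n.
pose N a : R := \sum_(b <- A) (defect h (a - b) < kap)%R%:R.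
have sumk (x : R) : \sum_(a <- A) x = x * k by exact: sum_const_seq.
have [/hasP[a0 a0A Na0]|/hasPn noN] := boolP (has (fun a => eta * k <= N a) A); last first.
  (* No point has [eta * k] close neighbours: the first term suffices, with 0 as an arbitrary
     centre. *)
  exists 0; rewrite -[X in X <= _]addr0 lerD ?sqr_ge0 // expr2 mulrA -sumk.
  by rewrite big_seq [leRHS]big_seq ler_sum // => a /noN; rewrite -ltNge => /ltW.
exists a0; pose c : R := \sum_(b <- A) (defect h (a0 - b) < 22 * kap)%R%:R.
have c0 : 0 <= c by apply: sumr_ge0 => b _; rewrite ler0n.
have Nle a : N a <= eta * k + (defect h (a0 - a) < 22 * kap)%R%:R * c.
  have [Na|Na] := leP (eta * k) (N a); last first.
    by rewrite -[X in X <= _]addr0 lerD ?(ltW Na) // mulr_ge0.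
  (* The constants come from [defectD]: 10 = 2 + 4 + 4 makes the defect of [b - b'] at least [kap],
     4 = 2 + 2 keeps [b - b'] near [a0 - a], and 22 = 2 * 10 + 2. *)
  have close : defect h (a0 - a) < 10 * kap.
    rewrite ltNge; apply/negP => far; have := sparse _ far.
    apply/negP; rewrite -leNgt; apply: (@le_trans _ _ (N a0 * N a)).
      by rewrite expr2 expr2 mulrACA ler_pM // mulr_ge0.
    rewrite mulr_suml; apply: ler_sum => b _; rewrite mulr_sumr; apply: ler_sum => b' _.
    have [n1|] := ltP (defect h (a0 - b)) kap; last by rewrite mul0r ler0n.
    have [n2|] := ltP (defect h (a - b')) kap; last by rewrite mulr0 ler0n.
    have -> : defect h (b - b' - (a0 - a)) < 4 * kap.
      have -> : b - b' - (a0 - a) = - (a0 - b) + (a - b') by ring.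
      by apply: le_lt_trans (defectD _ _ _) _; rewrite defectN; lra.
    have -> : kap <= defect h (b - b').
      have := defectD h (a0 - b) (b - a); have := defectD h (b - b') (- (a - b')).
      have -> : a0 - b + (b - a) = a0 - a by ring.
      have -> : b - b' + - (a - b') = b - a by ring.
      by rewrite defectN; lra.
    by rewrite mul1r.
  have -> : defect h (a0 - a) < 22 * kap by lra.
  rewrite mul1r -[X in X <= _]add0r lerD ?mulr_ge0 //; apply: ler_sum => b _.
  have [n1|//] := ltP (defect h (a - b)) kap.
  have -> // : defect h (a0 - b) < 22 * kap.
  have := defectD h (a0 - a) (a - b).
  have -> : a0 - a + (a - b) = a0 - b by ring.
  lra.
apply: (le_trans (ler_sum _ (fun a _ => Nle a))).
by rewrite big_split /= sumk -mulr_suml -/c -mulrA -!expr2.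
Qed.

(** * Trigonometric sums *)

(** This is a Riemann sum for the positive part of [- s - cos] on [0, t]. That part lives on
    [2 pi - t, t], with integral 2 pi s because [sin t = - s * t]; dividing by the step [t / n%:R]
    gives the main term. *)
Lemma threshold_sum (R : realType) (t s : R) (n : nat) :
  pi < t < 3 / 2 * pi -> cos t = - s -> sin t = - s * t -> 0 < s -> (0 < n)%N ->
  \sum_(0 <= i < n) Num.max (- s - cos (t / n%:R * i.+1%:R)) 0 <=
  n%:R * (2 * s - 2 * s * (1 - pi / t)) + (1 + t).
Proof.
move=> /andP[pit t32] ct st s0 n0; set h := t / n%:R.
have pi2 := @pi_ge2 R; have nR0 : 0 < n%:R :> R by rewrite ltr0n.
have t0 : 0 < t by lra.
have h0 : 0 < h by rewrite divr_gt0.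
have hn : h * n%:R = t by rewrite /h mulfVK // lt0r_neq0.
have cos2 x : cos (2 * pi - x) = cos x :> R.
  by rewrite -(cosN x) -(cosD2pi (- x)); congr cos; ring.
have sin2 x : sin (2 * pi - x) = - sin x :> R.
  by rewrite -(sinN x) -(sinD2pi (- x)); congr sin; ring.
pose y := (2 * pi - t) / h; have y0 : 0 <= y by rewrite divr_ge0 ?ltW //; lra.
have hy : h * y = 2 * pi - t by rewrite /y; field; rewrite lt0r_neq0.
set m := Num.truncn y.
have /andP[my ym] : m%:R <= y < m.+1%:R by exact: truncn_itv.
have mn : (m <= n)%N.
  rewrite -(ler_nat R) (le_trans my) // -(ler_pM2l h0) hn hy; lra.
have decr x z : 0 <= x -> x <= z -> z <= pi -> cos z <= cos x :> R.
  move=> x0 xz zpi; have [->//|ne] := eqVneq x z.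
  by apply/ltW; rewrite ltr_cos ?in_itv /=; lra.
(* [- s] is the value of [cos] at [t] and at its mirror image [2 pi - t]. *)
have low i : (i < m)%N -> Num.max (- s - cos (h * i.+1%:R)) 0 = 0.
  move=> im; have hi : h * i.+1%:R <= 2 * pi - t.
    by rewrite -hy ler_pM2l // (le_trans _ my) // ler_nat.
  have : cos (2 * pi - t) <= cos (h * i.+1%:R).
    by apply: decr => //; [rewrite mulr_ge0 // ltW|lra].
  by rewrite cos2 ct => c1; apply/max_idPr; lra.
have high i : (m <= i < n)%N ->
    Num.max (- s - cos (h * i.+1%:R)) 0 = - s - cos (h * i.+1%:R).
  move=> /andP[mi lt_in]; apply/max_idPl.
  have lo : 2 * pi - t <= h * i.+1%:R.
    by rewrite -hy ler_pM2l // (le_trans (ltW ym)) // ler_nat.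
  have hi : h * i.+1%:R <= t by rewrite -hn ler_pM2l // ler_nat.
  rewrite subr_ge0 -ct; have [le|/ltW ge] := leP (h * i.+1%:R) pi.
    by rewrite -(cos2 t); apply: decr => //; lra.
  by rewrite -(cos2 t) -(cos2 (h * _)); apply: decr; lra.
rewrite (big_cat_nat (leq0n m) mn) /= big_nat_cond big1 ?add0r; last first.
  by move=> i /andP[/andP[_ im] _]; rewrite low.
rewrite (eq_big_nat _ _ high) sumrB sumr_const_nat -mulr_natr.
have := cos_sum_approx (ltW h0) mn; rewrite hn st.
have hm : h * m%:R <= 2 * pi - t by rewrite -hy ler_pM2l.
have := sin_lipschitz hm; rewrite sin2 st.
set S := \sum_(m <= i < n) _; rewrite !ler_norml => /andP[l1 _] /andP[l2 _].
have hm1 : 2 * pi - t <= h * m%:R + h.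
  have : h * y <= h * m.+1%:R by rewrite ler_pM2l // ltW.
  by rewrite hy -[m.+1%:R]natr1 (mulrDr h) mulr1.
have nm : (n - m)%:R * h ^+ 2 <= t * h.
  rewrite -hn mulrAC -expr2 [leRHS]mulrC ler_wpM2r ?sqr_ge0 // ler_nat; exact: leq_subr.
have hS : - (2 * s * n%:R) - 1 - t <= S.
  rewrite -(ler_pM2l h0).
  have -> : h * (- (2 * s * n%:R) - 1 - t) = - (2 * s * t) - h - t * h.
    by rewrite -hn; ring.
  lra.
have nm2 : 2 * n%:R * (1 - pi / t) <= (n - m)%:R.
  rewrite natrB // -(ler_pM2l h0).
  have -> : h * (2 * n%:R * (1 - pi / t)) = 2 * t - 2 * pi.
    by rewrite -{2}hn /h; field; rewrite !lt0r_neq0.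
  by rewrite mulrBr hn; lra.
have : s * (2 * n%:R * (1 - pi / t)) <= s * (n - m)%:R by rewrite ler_pM2l.
lra.
Qed.

Lemma double_cos_sum (R : realType) (h : R) (A : seq int) (f : int -> R) :
  \sum_(a <- A) \sum_(b <- A) f a * f b * cos (h * (a - b)%:~R) =
  (\sum_(a <- A) f a * cos (h * a%:~R)) ^+ 2 + (\sum_(a <- A) f a * sin (h * a%:~R)) ^+ 2.
Proof.
rewrite !expr2 !mulr_suml -big_split; apply: eq_bigr => a _ /=.
rewrite !mulr_sumr -big_split; apply: eq_bigr => b _ /=.
by rewrite intrB mulrBr cosB; ring.
Qed.

(** For [x] the indicator of a cluster, the weight selects the pairs with exactly one member in it,
    and U C + V S - C^2 - S^2 is the real part of its exponential sum times the conjugate of that of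
    its complement. *)
Lemma cross_cos_sum (R : realType) (h s : R) (A : seq int) (x : int -> R) :
  let c := \sum_(a <- A) x a in
  let U := \sum_(a <- A) cos (h * a%:~R) in
  let V := \sum_(a <- A) sin (h * a%:~R) in
  let C := \sum_(a <- A) x a * cos (h * a%:~R) in
  let S := \sum_(a <- A) x a * sin (h * a%:~R) in
  \sum_(a <- A) \sum_(b <- A)
    (x a * (1 - x b) + (1 - x a) * x b) * (- s - cos (h * (a - b)%:~R)) =
  2 * (- s * c * ((size A)%:R - c) - (U * C + V * S) + (C ^+ 2 + S ^+ 2)).
Proof.
move=> c U V C S; set k : R := (size A)%:R.
pose p a := cos (h * a%:~R); pose q a := sin (h * a%:~R).
have lin (w1 w2 w3 w4 w5 w6 : R) :
    \sum_(a <- A) (w1 + w2 * x a + w3 * p a + w4 * (x a * p a) + w5 * q a + w6 * (x a * q a)) =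
    w1 * k + w2 * c + w3 * U + w4 * C + w5 * V + w6 * S.
  by rewrite !big_split /= -!mulr_sumr sum_const_seq.
transitivity (\sum_(a <- A) (- s * c + (- s * k + 2 * s * c) * x a + (- C) * p a +
    (- U + 2 * C) * (x a * p a) + (- S) * q a + (- V + 2 * S) * (x a * q a))); last first.
  by rewrite lin; ring.
apply: eq_bigr => a _.
transitivity (\sum_(b <- A) (- s * x a + (- s + 2 * s * x a) * x b + (- (x a * p a)) * p b +
    (- p a + 2 * (x a * p a)) * (x b * p b) + (- (x a * q a)) * q b +
    (- q a + 2 * (x a * q a)) * (x b * q b))); last first.
  by rewrite lin; ring.
by apply: eq_bigr => b _; rewrite intrB (mulrBr h) cosB -/(p a) -/(p b) -/(q a) -/(q b); ring.
Qed.

Lemma sum_cos_le (R : realType) (t s : R) (n : nat) :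
  0 < t -> sin t = - s * t -> (0 < n)%N ->
  \sum_(0 <= i < n) cos (t / n%:R * i.+1%:R) <= - s * n%:R + t.
Proof.
move=> t0 st n0; have nR0 : 0 < n%:R :> R by rewrite ltr0n.
have h0 : 0 < t / n%:R by rewrite divr_gt0.
have hn : t / n%:R * n%:R = t by rewrite mulfVK // lt0r_neq0.
have := cos_sum_approx (ltW h0) (leq0n n); rewrite hn st mulr0 sin0 subr0 subn0.
set h := t / n%:R in h0 hn *; set S := \sum_(_ <= _ < _) _.
rewrite ler_norml => /andP[_ le]; rewrite -(ler_pM2l h0) mulrDr mulrCA hn.
have eE : n%:R * h ^+ 2 = h * t by rewrite -hn; ring.
by rewrite eE in le; lra.
Qed.

(** The total defect is k^2 - |sum_a z_a|^2, and over [sym_range n] it is at least 2 (1 + s) n - 2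
    t. For a covering [A] both terms on the left are nonnegative, so a size near the bound makes
    both small. *)
Lemma excess_le (R : realType) (t s : R) (n : nat) (A : seq int) :
  0 < t -> sin t = - s * t -> (0 < n)%N ->
  excess (t / n%:R) n A + \sum_(a <- A) \sum_(b <- A) cos (t / n%:R * (a - b)%:~R)
  <= (size A)%:R ^+ 2 - 2 * (1 + s) * n%:R + 2 * t.
Proof.
move=> t0 st n0; have := sum_cos_le t0 st n0.
rewrite /excess sum_sym_range; set h := t / n%:R.
have -> : \sum_(a <- A) \sum_(b <- A) defect h (a - b) =
    (size A)%:R ^+ 2 - \sum_(a <- A) \sum_(b <- A) cos (h * (a - b)%:~R).
  rewrite expr2 -sum_const_seq -sumrB; apply: eq_bigr => a _.
  by rewrite sumrB sum_const_seq mul1r.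
have -> : \sum_(0 <= i < n) (defect h (i.+1)%:Z + defect h (- (i.+1)%:Z)) =
    2 * (n%:R - \sum_(0 <= i < n) cos (h * i.+1%:R)).
  have nE : \sum_(0 <= i < n) (1 : R) = n%:R by rewrite sumr_const_nat subn0.
  rewrite -nE -sumrB mulr_sumr; apply: eq_bigr => i _.
  by rewrite defectN /defect -pmulrn; ring.
lra.
Qed.

(** * Structure of a nearly optimal basis *)

(** At most 2n plus [excess / kap] pairs have defect at least [kap], so k^2 - 2n, about 2sn, pairs
    remain close; [cluster] gathers them around one point. *)
Lemma cluster_exists (R : realType) (t s xi kap eta : R) (M n : nat) (A : seq int) :
  let h := t / n%:R in
  0 < t <= 2 * pi -> 0 <= s -> sin t = - s * t -> 2 * t <= xi * n%:R -> 0 < xi ->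
  0 < kap -> kap = (1 - cos (t / (4 * M%:R))) / 16 -> 0 <= eta -> xi <= s ->
  (0 < M)%N -> (4 * M <= n)%N -> 4 <= eta ^+ 2 * M%:R -> 4 * xi < eta ^+ 2 * kap ->
  covers n A -> (size A)%:R ^+ 2 <= (2 + 2 * s + xi) * n%:R ->
  exists a0, (2 * s - xi - 2 * xi / kap) * n%:R - eta * (size A)%:R ^+ 2 <=
    (\sum_(b <- A) (defect h (a0 - b) < 22 * kap)%R%:R) ^+ 2.
Proof.
move=> h /andP[t0 tpi] s0 st tn xi0 kap0 kapE eta0 xis M0 Mn M4 xik cov k2le.
have n0 : (0 < n)%N by apply: leq_trans Mn; rewrite muln_gt0.
have n4 : (3 * n + 1 <= 4 * n)%N by move: n0; clear; lia.
have nR0 : 0 < n%:R :> R by rewrite ltr0n.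
have := excess_le A t0 st n0; rewrite -/h.
set k : R := (size A)%:R in k2le *; set X := excess h n A.
set Z := \sum_(a <- A) _ => XZ.
have Z0 : 0 <= Z.
  have -> : Z = \sum_(a <- A) \sum_(b <- A) 1 * 1 * cos (h * (a - b)%:~R).
    by apply: eq_bigr => a _; apply: eq_bigr => b _; rewrite !mul1r.
  by rewrite (double_cos_sum h A (fun=> 1)) addr_ge0 ?sqr_ge0.
have X0 : 0 <= X by rewrite subr_ge0 sum_diff_ge // => d; exact: defect_ge0.
have xiN : xi * n%:R <= s * n%:R by rewrite ler_pM2r.
have k2ge : 2 * n%:R <= k ^+ 2 by lra.
have Xle : X <= 2 * xi * n%:R by lra.
have Xkle : X / kap <= 2 * xi / kap * n%:R.
  by rewrite mulrAC ler_pM2r ?invr_gt0.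
have XkE : kap^-1 * X = X / kap by rewrite mulrC.
have far_le (G : pred int) : (forall d, G d -> kap <= defect h d) ->
    \sum_(a <- A) \sum_(b <- A) (G (a - b))%:R <=
    \sum_(d <- sym_range n) (G d)%:R + 2 * xi / kap * n%:R.
  move=> Gfar; apply: le_trans (lerD (lexx _) Xkle).
  rewrite -XkE; apply: (@sum_diff_le R h kap^-1 n A (fun d => (G d)%:R)) => // d.
  case: (boolP (G d)) => [/Gfar le|_] /=.
    by rewrite mulrC ler_pdivlMr // mul1r.
  by rewrite mulr_ge0 ?defect_ge0 // invr_ge0 ltW.
have [D far|a0 near] := @cluster R h kap eta A kap0 eta0.
  (* Sparsity holds: differences near [D] are few by [window_count], and repetitions away from 0 are
     paid for by the excess. *)
  have := @far_le (fun d => (defect h (d - D) < 4 * kap) && (kap <= defect h d)).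
  move=> /(_ (fun d => ltac:(by case/andP))) /= dense.
  apply: le_lt_trans dense _.
  have Mpos : 0 < M%:R :> R by rewrite ltr0n.
  have W : \sum_(d <- sym_range n) ((defect h (d - D) < 4 * kap) && (kap <= defect h d))%R%:R
      <= eta ^+ 2 * n%:R :> R.
    apply: (@le_trans _ _ (\sum_(d <- sym_range n) (defect h (d - D) < 4 * kap)%R%:R)).
      by apply: ler_sum => d _; case: (_ < _); rewrite ?ler_nat ?leq_b1.
    have := @window_count R t M n D; rewrite t0 tpi => /(_ erefl M0 Mn).
    have -> : (1 - cos (t / (4 * M%:R))) / 4 = 4 * kap by rewrite kapE; lra.
    rewrite -/h => W; rewrite -(ler_pM2l Mpos) (le_trans W) //.
    apply: (@le_trans _ _ (4 * n%:R)); first by rewrite -natrM ler_nat.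
    by rewrite mulrA [_ * eta ^+ 2]mulrC ler_pM2r.
  have : 2 * xi / kap * n%:R < eta ^+ 2 * n%:R.
    by rewrite ltr_pM2r // ltr_pdivrMr // (le_lt_trans _ xik) //; lra.
  have : eta ^+ 2 * (2 * n%:R) <= eta ^+ 2 * k ^+ 2 by rewrite ler_wpM2l ?sqr_ge0.
  lra.
exists a0; rewrite lerBlDl; apply: le_trans near.
have := @far_le (fun d => kap <= defect h d) (fun d => id).
set far := \sum_(a <- A) _; set near := \sum_(a <- A) _.
have : near + far = k ^+ 2.
  rewrite expr2 -sum_const_seq -big_split; apply: eq_bigr => a _ /=.
  rewrite -big_split -[RHS]mul1r -sum_const_seq; apply: eq_bigr => b _ /=.
  by case: ltP => _; rewrite ?addr0 ?add0r.
have : \sum_(d <- sym_range n) (kap <= defect h d)%R%:R <= 2 * n%:R :> R.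
  apply: (@le_trans _ _ (\sum_(d <- sym_range n) 1)).
    by apply: ler_sum => d _; rewrite lern1 leq_b1.
  by rewrite sum_const_seq size_cat !size_map size_iota mul1r natrD; lra.
lra.
Qed.

(** Sums [- s - cos] over the pairs between cluster and complement. From above, its positive part is
    at most the defect, so [threshold_sum] and the excess bound it; from below, the full exponential
    sum is small while that of the cluster is nearly [c] in modulus. *)
Lemma cross_bound (R : realType) (t s xi kap : R) (n : nat) (A : seq int) (a0 : int) :
  let h := t / n%:R in
  let k : R := (size A)%:R in
  let c : R := \sum_(b <- A) (defect h (a0 - b) < 22 * kap)%R%:R in
  pi < t < 3 / 2 * pi -> cos t = - s -> sin t = - s * t -> 0 < s ->
  0 < kap <= 1 -> (0 < n)%N -> 2 * (1 + t) <= xi * n%:R ->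
  covers n A -> k ^+ 2 <= (2 + 2 * s + xi) * n%:R ->
  2 * (- s * c * (k - c) + (1 - 89 * kap) * c ^+ 2) - xi * n%:R / kap <=
  n%:R * (4 * s - 4 * s * (1 - pi / t)) + 4 * (xi * n%:R).
Proof.
move=> h k c pit ct st s0 /andP[kap0 kap1] n0 tn cov k2le.
have t0 : 0 < t by have := @pi_ge2 R; case/andP: pit; lra.
have := excess_le A t0 st n0; rewrite -/h -/k; set X := excess h n A.
pose x b : R := (defect h (a0 - b) < 22 * kap)%R%:R.
pose U := \sum_(a <- A) cos (h * a%:~R); pose V := \sum_(a <- A) sin (h * a%:~R).
pose C := \sum_(a <- A) x a * cos (h * a%:~R).
pose S := \sum_(a <- A) x a * sin (h * a%:~R).
have -> : \sum_(a <- A) \sum_(b <- A) cos (h * (a - b)%:~R) = U ^+ 2 + V ^+ 2.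
  transitivity (\sum_(a <- A) \sum_(b <- A) 1 * 1 * cos (h * (a - b)%:~R)).
    by apply: eq_bigr => a _; apply: eq_bigr => b _; rewrite !mul1r.
  rewrite (double_cos_sum h A (fun=> 1)).
  by congr (_ ^+ 2 + _ ^+ 2); apply: eq_bigr => a _; rewrite mul1r.
move=> XZ.
have X0 : 0 <= X by rewrite subr_ge0 sum_diff_ge // => d; exact: defect_ge0.
have {}XZ : X + (U ^+ 2 + V ^+ 2) <= 2 * (xi * n%:R) by lra.
have UV0 : 0 <= U ^+ 2 + V ^+ 2 by rewrite addr_ge0 ?sqr_ge0.
pose G d : R := Num.max (- s - cos (h * d%:~R)) 0.
have GE : \sum_(d <- sym_range n) G d =
    2 * \sum_(0 <= i < n) Num.max (- s - cos (h * i.+1%:R)) 0.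
  rewrite sum_sym_range mulr_sumr; apply: eq_bigr => i _.
  by rewrite /G mulrNz mulrN cosN -pmulrn; ring.
have G_le : \sum_(a <- A) \sum_(b <- A) G (a - b) <= \sum_(d <- sym_range n) G d + 1 * X.
  apply: sum_diff_le => // d; rewrite mul1r ge_max defect_ge0 andbT /defect lerD2r; lra.
have := threshold_sum pit ct st s0 n0; rewrite -/h => thr.
have cross_le : \sum_(a <- A) \sum_(b <- A)
    (x a * (1 - x b) + (1 - x a) * x b) * (- s - cos (h * (a - b)%:~R)) <=
    \sum_(a <- A) \sum_(b <- A) G (a - b).
  apply: ler_sum => a _; apply: ler_sum => b _; rewrite /x.
  by case: (_ < _); case: (_ < _); rewrite /= ?subrr ?subr0 ?mulr0 ?mul0r ?mulr1 ?addr0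
    ?add0r ?mul0r ?mul1r le_max lexx ?orbT.
have {cross_le}G_ge := cross_le.
rewrite (cross_cos_sum h s A x) -/U -/V -/C -/S -/k -[\sum_(a <- A) x a]/c in G_ge.
(* By [defectD], two cluster points have mutual defect at most [88 * kap], as 88 = 2 * 22 + 2 *
   22. *)
have CS : (1 - 88 * kap) * c ^+ 2 <= C ^+ 2 + S ^+ 2.
  rewrite -double_cos_sum expr2 mulr_suml mulr_sumr; apply: ler_sum => a _.
  rewrite !mulr_sumr; apply: ler_sum => b _; rewrite /x.
  case: (ltP (defect h (a0 - a)) (22 * kap)) => [n1|_] /=; last by rewrite !(mul0r, mulr0).
  case: (ltP (defect h (a0 - b)) (22 * kap)) => [n2|_] /=; last by rewrite !(mul0r, mulr0).
  rewrite !mul1r mulr1.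
  have := defectD h (- (a0 - a)) (a0 - b); rewrite defectN.
  have -> : - (a0 - a) + (a0 - b) = a - b by ring.
  by rewrite [defect h (a - b)]/defect; lra.
(* This weight costs one more [kap] of [C ^+ 2 + S ^+ 2], turning 88 into 89. *)
have amgm (u v : R) : u * v <= kap * v ^+ 2 + u ^+ 2 / (4 * kap).
  have -> : kap * v ^+ 2 + u ^+ 2 / (4 * kap) = u * v + (u - 2 * kap * v) ^+ 2 / (4 * kap).
    by field; rewrite lt0r_neq0.
  by rewrite lerDl divr_ge0 ?sqr_ge0 // mulr_ge0 // ltW.
have UCVS := lerD (amgm U C) (amgm V S).
have Zk : (U ^+ 2 + V ^+ 2) / (4 * kap) <= xi * n%:R / kap / 2.
  have -> : xi * n%:R / kap / 2 = 2 * (xi * n%:R) / (4 * kap).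
    by field; rewrite lt0r_neq0.
  by rewrite ler_pM2r ?invr_gt0 ?mulr_gt0 //; lra.
have CS1 : (1 - 89 * kap) * c ^+ 2 <= (1 - kap) * (C ^+ 2 + S ^+ 2).
  have h1 : 0 <= 1 - kap by lra.
  apply: le_trans (ler_wpM2l h1 CS).
  have := sqr_ge0 c; have := sqr_ge0 (kap * c); rewrite exprMn; nra.
rewrite mulrDl in Zk.
lra.
Qed.

(** * Numerical contradiction and choice of constants *)

(** [P] stands for 1 - pi / t. Up to errors, c^2 >= 2 s N and k^2 <= (2 + 2 s) N turn the last
    inequality, after AM-GM, into 2 P <= s (47/20) + (1 + s) (20/47) - 2 s, which fails by [mu]. *)
Lemma tolerances_contradiction (R : realType) (s P mu xi kap eta N c k : R) :
  0 < s < 111 / 500 -> 0 < mu -> 0 < N -> 0 <= c <= k ->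
  0 < xi <= s -> 0 < kap -> 0 <= eta ->
  s * (47 / 20) + (1 + s) * (20 / 47) - 2 * s + mu = 2 * P ->
  6 * eta + 534 * kap + 5 * (xi / kap) + 7 * xi < 2 * (s * mu) ->
  k ^+ 2 <= (2 + 2 * s + xi) * N ->
  (2 * s - xi - 2 * xi / kap) * N - eta * k ^+ 2 <= c ^+ 2 ->
  2 * (- s * c * (k - c) + (1 - 89 * kap) * c ^+ 2) - xi * N / kap <=
    N * (4 * s - 4 * s * P) + 4 * (xi * N) -> False.
Proof.
move=> /andP[s0 s1] mu0 N0 /andP[c0 ck] /andP[xi0 xis] kap0 eta0 muE small k2 c2 main.
have eE : 2 * xi / kap = 2 * (xi / kap) by rewrite mulrA.
have eE2 : xi * N / kap = xi / kap * N by rewrite mulrAC.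
set e := xi / kap in small eE eE2; rewrite eE in c2; rewrite eE2 in main.
have e0 : 0 < e by rewrite divr_gt0.
have k3 : k ^+ 2 <= 3 * N.
  apply: le_trans k2 _; rewrite ler_pM2r //; lra.
have c3 : c ^+ 2 <= 3 * N by apply: le_trans k3; rewrite ler_sqr ?nnegrE // (le_trans c0).
have ek : eta * k ^+ 2 <= eta * (3 * N) by rewrite ler_wpM2l.
have kc : kap * c ^+ 2 <= kap * (3 * N) by rewrite ler_pM2l.
(* AM-GM with weight [47/20], close to the ratio [k / c = sqrt ((1 + s) / s)] of the
   limiting case. *)
have amgm : s * (2 * c * k) <= s * (47 / 20 * c ^+ 2 + 20 / 47 * k ^+ 2).
  rewrite ler_pM2l //; have := sqr_ge0 (47 / 20 * c - k); lra.
have sk : s * k ^+ 2 <= s * ((2 + 2 * s + xi) * N) by rewrite ler_pM2l.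
pose B := 2 + 2 * s - s * (47 / 20).
have B0 : 0 <= B by rewrite /B; lra.
have B2 : B <= 2 by rewrite /B; lra.
have Bc : B * ((2 * s - xi - 2 * e) * N - eta * (3 * N)) <= B * c ^+ 2.
  by rewrite ler_wpM2l //; lra.
have err0 : 0 <= (xi + 2 * e + 3 * eta) * N by rewrite mulr_ge0 ?ltW //; lra.
have Berr : B * ((xi + 2 * e + 3 * eta) * N) <= 2 * ((xi + 2 * e + 3 * eta) * N).
  by rewrite ler_wpM2r.
have xiN : 0 <= xi * N by rewrite mulr_ge0 ?ltW.
have sxi : s * (xi * N) <= xi * N by rewrite ler_piMl ?mulr_ge0 ?ltW //; lra.
(* From [k ^+ 2 <= 3 * N] and [B <= 2]: 6 = 2 * 3, 534 = 2 * 89 * 3, 5 = 2 * 2 + 1, 7 = 2 + 4 +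
   1. *)
have smallN : (6 * eta + 534 * kap + 5 * e + 7 * xi) * N < 2 * (s * mu) * N.
  by rewrite ltr_pM2r.
have muE' : 2 * (s * mu) * N =
    4 * s * P * N - 2 * s * (s * (47 / 20) + (1 + s) * (20 / 47) - 2 * s) * N.
  have -> : mu = 2 * P - (s * (47 / 20) + (1 + s) * (20 / 47) - 2 * s) by lra.
  ring.
have BE : B * (2 * s * N) = 2 * s * N * (2 + 2 * s - s * (47 / 20)) by rewrite mulrC.
rewrite muE' in smallN; rewrite /B in Bc Berr BE; lra.
Qed.

(** [kap] is of order 1 / M^2; a bound of order 1 / M already makes it small for large [M]. *)
Lemma cos_gap_bounds (R : realType) (t : R) (M : nat) : 0 < t <= 6 -> (0 < M)%N ->
  let kap := (1 - cos (t / (4 * M%:R))) / 16 in 0 < kap /\ kap * M%:R <= 9 / 128.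
Proof.
move=> /andP[t0 t6] M0; have M1 : 1 <= M%:R :> R by rewrite ler1n.
have Mpos : 0 < M%:R :> R by rewrite ltr0n.
set y := t / (4 * M%:R) => kap.
have y0 : 0 < y by rewrite divr_gt0 ?mulr_gt0.
have yM : y * M%:R <= 3 / 2.
  have -> : y * M%:R = t / 4 by rewrite /y; field; rewrite lt0r_neq0.
  lra.
have y32 : y <= 3 / 2 by apply: le_trans yM; rewrite ler_peMr // ltW.
split.
  have pi2 := @pi_ge2 R.
  rewrite divr_gt0 // subr_gt0 -[ltRHS](@cos0 R) ltr_cos ?in_itv /= ?lexx ?pi_ge0 ?(ltW y0) //.
  by apply: le_trans y32 (le_trans _ pi2); clear; lra.
have y02 : 0 <= y <= 2 by rewrite (ltW y0) (le_trans y32) //; clear; lra.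
have kapy : kap <= y ^+ 2 / 32 by have := cos_ge_quadratic y02; rewrite /kap; lra.
apply: (@le_trans _ _ (y ^+ 2 / 32 * M%:R)); first by rewrite ler_pM2r.
have : y * (y * M%:R) <= 3 / 2 * (3 / 2).
  by apply: ler_pM => //; [exact: ltW|exact/ltW/mulr_gt0].
rewrite expr2; lra.
Qed.

Lemma basis_size_lower (R : realType) : exists s xi : R,
  [/\ - s <= sinc_inf R, 0 < xi & exists N0 : nat, forall (n : nat) (A : seq int),
    (N0 <= n)%N -> covers n A -> (2 + 2 * s + xi) * n%:R < (size A)%:R ^+ 2].
Proof.
have [t [s [pit ct st [/andP[s1 s2] s2pi] num]]] := sinc_critical_point R.
have pi2 := @pi_ge2 R; have pi4 : pi < 4 :> R by have := pihalf_lt2 R; lra.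
have s0 : 0 < s by lra.
have [t0 t6] : 0 < t /\ t <= 6 by case/andP: (pit) => ? ?; split; lra.
have tpi : 0 < t <= 2 * pi by case/andP: (pit) => ? ?; lra.
pose mu := 2 * (1 - pi / t) - (s * (47 / 20) + (1 + s) * (20 / 47) - 2 * s).
have mu0 : 0 < mu by rewrite /mu; lra.
have mu2 : mu < 2.
  have : 0 < pi / t by rewrite divr_gt0 //; lra.
  rewrite /mu; lra.
have smu0 : 0 < s * mu by rewrite mulr_gt0.
have smu1 : s * mu < 2 * s by rewrite mulrC ltr_pM2r.
(* The constants are fixed in the order [eta], [M], [kap], [xi], [n], with [s * mu] as the available
   margin. *)
pose eta := s * mu / 100; have eta0 : 0 < eta by rewrite divr_gt0.
have eta2 : 0 < eta ^+ 2 by rewrite exprn_gt0.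
have eta2_le : eta ^+ 2 <= eta by rewrite expr2 ler_piMl ?ltW // /eta; clear -smu1 s2; lra.
(* The first summand makes arcs sparse; the second gives [534 * kap <= s * mu / 2], as 534 * 9 / 128
   < 40. *)
pose M := (Num.truncn (4 / eta ^+ 2 + 80 / (s * mu))).+1.
have Mgt : 4 / eta ^+ 2 + 80 / (s * mu) < M%:R by exact: truncnS_gt.
have Mpos : 0 < M%:R :> R by rewrite ltr0n.
have M4 : 4 <= eta ^+ 2 * M%:R.
  rewrite mulrC -ler_pdivrMr // ltW // (le_lt_trans _ Mgt) // lerDl.
  by rewrite divr_ge0 // ltW.
have M80 : 80 <= s * mu * M%:R.
  rewrite mulrC -ler_pdivrMr // ltW // (le_lt_trans _ Mgt) // lerDr.
  by rewrite divr_ge0 // ltW.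
pose kap := (1 - cos (t / (4 * M%:R))) / 16.
have [kap0 kapM] : 0 < kap /\ kap * M%:R <= 9 / 128.
  by apply: cos_gap_bounds; rewrite ?t0.
have kap534 : 534 * kap <= s * mu / 2.
  rewrite -(ler_pM2r Mpos); clear -kapM M80; lra.
have kap1 : kap <= 1 by clear -kap534 smu1 s2; lra.
(* The factor [kap] keeps [xi / kap] small. *)
pose xi := kap * (eta ^+ 2 / 8).
have xi0 : 0 < xi by apply: mulr_gt0 => //; apply: divr_gt0.
have xi_le : xi <= eta ^+ 2 / 8 by rewrite ler_piMl //; apply: divr_ge0 => //; exact: ltW.
have etas : eta <= s by rewrite /eta; clear -smu1 s0; lra.
have xis : xi <= s by clear -xi_le eta2_le etas eta0; lra.
have xik : xi / kap = eta ^+ 2 / 8 by rewrite /xi; field; rewrite lt0r_neq0.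
exists s, xi; split => //; first exact: (sinc_inf_ge pit ct st s2pi).
exists (4 * M + (Num.truncn (14 / xi)).+1)%N => n A nN cov.
have Mn : (4 * M <= n)%N by apply: leq_trans nN; rewrite leq_addr.
have n0 : (0 < n)%N by apply: leq_trans Mn.
have n14 : 14 <= xi * n%:R.
  rewrite mulrC -ler_pdivrMr // ltW // (lt_le_trans (truncnS_gt _)) // ler_nat.
  by apply: leq_trans nN; rewrite leq_addl.
have nR0 : 0 < n%:R :> R by rewrite ltr0n.
rewrite ltNge; apply/negP => k2.
have tn : 2 * t <= xi * n%:R by clear -t6 n14; lra.
have tn1 : 2 * (1 + t) <= xi * n%:R by clear -t6 n14; lra.
have xi4 : 4 * xi < eta ^+ 2 * kap.
  have := mulr_gt0 eta2 kap0; rewrite /xi; clear; lra.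
have [a0] := cluster_exists tpi (ltW s0) st tn xi0 kap0 erefl (ltW eta0) xis (ltn0Sn _)
  Mn M4 xi4 cov k2.
have kap01 : 0 < kap <= 1 by rewrite kap0.
have := @cross_bound R t s xi kap n A a0 pit ct st s0 kap01 n0 tn1 cov k2.
set c : R := \sum_(b <- A) _ => main c2.
apply: (@tolerances_contradiction R s (1 - pi / t) mu xi kap eta n%:R c (size A)%:R) => //.
- by rewrite s0.
- rewrite sumr_ge0 //= -[leRHS]mul1r -sum_const_seq ler_sum // => b _.
  by rewrite lern1 leq_b1.
- by rewrite xi0.
- exact: ltW.
- by rewrite /mu; ring.
- rewrite xik; move: eta2_le xi_le kap534; rewrite /eta; clear -smu0; lra.
Qed.

(** * Passage to the limit *)

Lemma Dmin_covers (n : nat) : exists2 A : seq int, covers n A & size A = Dmin n.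
Proof.
rewrite /Dmin; case: ex_minnP => k /asboolP[A basis cardA] _.
exists A => // i lt_in; have [|a aA [b bA e]] := basis (i.+1)%:Z; last by exists a, b.
by rewrite /=; lia.
Qed.

Theorem theorem1p3 (R : realType) (dstar : R)
  (hdstar : (((Dmin n)%:R ^+ 2 / n%:R : R) @[n --> \oo]) --> dstar) :
  exists2 eps : R, 0 < eps & dstar >= eps + 2 - 2 * sinc_inf R.
Proof.
have [s [xi [sinc_ge xi0 [N0 lower]]]] := basis_size_lower R.
exists xi => //; suff : 2 + 2 * s + xi <= dstar by lra.
apply: (cvgr_to_ge hdstar); near=> n.
have n0 : (0 < n)%N by near: n; exact: nbhs_infty_gt.
have [A cov <-] := Dmin_covers n.
rewrite ler_pdivlMr ?ltr0n // ltW // lower //.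
by near: n; exact: nbhs_infty_ge.
Unshelve. all: by end_near.
Qed.
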